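(* Let $$G_0=\langle a,b\mid a^{91}=1,\ b^3=1,\ bab^{-1}=a^9\rangle,\qquad H_0=\langle \alpha,\beta\mid \alpha^{91}=1,\ \beta^3=1,\ \beta\alpha\beta^{-1}=\alpha^{16}\rangle.$$ Then the subrack lattices $\mathcal{R}(G_0)$ and $\mathcal{R}(H_0)$ are isomorphic as lattices, but $G_0$ and $H_0$ are not isomorphic as racks (that is, there is no bijection $f\colon G_0\to H_0$ with $f(xyx^{-1})=f(x)f(y)f(x)^{-1}$ for all $x,y\in G_0$).
   Context: A rack is a set $X$ with a binary operation $\triangleright\colon X\times X\to X$ such that (A1) $a\triangleright(b\triangleright c)=(a\triangleright b)\triangleright(a\triangleright c)$ for all $a,b,c\in X$, and (A2) for all $a,c\in X$ there is a unique $b\in X$ with $a\triangleright b=c$. A subrack of $X$ is a subset (possibly empty) that is itself a rack under the restricted operation. A group $G$ is regarded as a rack (the group rack) via conjugation $a\triangleright b:=aba^{-1}$. $\mathcal{R}(X)$ denotes the set of all subracks of $X$ ordered by inclusion; it is a lattice, called the subrack lattice of $X$. *)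

(* Defs.v *)
From HB Require Import structures.
From mathcomp Require Import all_boot all_order all_algebra all_fingroup.
From mathcomp Require Import all_solvable.

Set Implicit Arguments.
Unset Strict Implicit.
Unset Printing Implicit Defensive.

HB.mixin Record isRack X := {
  rack_op : X -> X -> X;
  rack_opDr : forall a b c : X,
    rack_op a (rack_op b c) = rack_op (rack_op a b) (rack_op a c);
  rack_op_solve : forall a c : X, exists! b : X, rack_op a b = c
}.

#[short(type="rackType")]
HB.structure Definition Rack := {X of isRack X}.

#[short(type="finRackType")]
HB.structure Definition FinRack := {X of isRack X & Finite X}.

Declare Scope rack_scope.
Delimit Scope rack_scope with rack.
Notation "a ▷ b" := (rack_op a b)
  (at level 40, left associativity) : rack_scope.
Local Open Scope rack_scope.

Definition rack_isomorphic (X Y : rackType) : Prop :=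
  exists2 f : X -> Y, bijective f & {morph f : a b / a ▷ b}.

Section GroupRack.
Variable gT : finGroupType.

(* An alias of [gT], so that the rack structure does not become a canonical
   structure of every finite group. *)
Definition group_rack : Type := gT.

HB.instance Definition _ := Finite.on group_rack.

Definition conj_op (a b : group_rack) : group_rack :=
  ((a : gT) * b * (a : gT)^-1)%g.

Fact conj_opDr a b c :
  conj_op a (conj_op b c) = conj_op (conj_op a b) (conj_op a c).
Proof. by rewrite /conj_op !invMg invgK !mulgA !mulgKV. Qed.

Fact conj_op_solve a c : exists! b, conj_op a b = c.
Proof.
exists ((a : gT)^-1 * c * (a : gT))%g.
by split=> [|b <-]; rewrite /conj_op !mulgA ?mulgV ?mulVg ?mul1g ?mulgK ?mulgKV.
Qed.

HB.instance Definition _ := isRack.Build group_rack conj_opDr conj_op_solve.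

End GroupRack.

Section Subracks.
Variable X : finRackType.
Implicit Type S : {set X}.

(* The restriction of [▷] to [S] is a well-defined operation satisfying the
   two rack axioms; [S] may be empty. *)
Definition is_subrack S : bool :=
  [&& [forall a in S, forall b in S, a ▷ b \in S],
      [forall a in S, forall b in S, forall c in S,
         a ▷ (b ▷ c) == (a ▷ b) ▷ (a ▷ c)]
    & [forall a in S, forall c in S, exists b in S,
         (a ▷ b == c) && [forall b' in S, (a ▷ b' == c) ==> (b' == b)]]].

Lemma is_subrackP S :
  reflect [/\ {in S &, forall a b, a ▷ b \in S},
              {in S & S & S, forall a b c, a ▷ (b ▷ c) = (a ▷ b) ▷ (a ▷ c)}
            & {in S &, forall a c, exists! b, b \in S /\ a ▷ b = c}]
          (is_subrack S).
Proof.
apply: (iffP and3P) => -[S_cl S_A1 S_A2]; split.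
- by move=> a b aS bS; have /forall_inP/(_ a aS)/forall_inP := S_cl; apply.
- by move=> a b c _ _ _; apply: rack_opDr.
- move=> a c aS cS.
  have /forall_inP/(_ a aS)/forall_inP/(_ c cS)/exists_inP := S_A2.
  case=> b bS /andP[/eqP def_c /forall_inP b_uniq].
  exists b; split=> // b' [b'S /eqP].
  by move: (b_uniq b' b'S) => /implyP/[apply]/eqP.
- by apply/forall_inP=> a aS; apply/forall_inP=> b bS; apply: S_cl.
- apply/forall_inP=> a aS; apply/forall_inP=> b bS; apply/forall_inP=> c cS.
  by apply/eqP/S_A1.
apply/forall_inP=> a aS; apply/forall_inP=> c cS.
have [b [[bS def_c] b_uniq]] := S_A2 a c aS cS.
apply/exists_inP; exists b => //; rewrite def_c eqxx /=.
apply/forall_inP=> b' b'S; apply/implyP=> /eqP def_c'.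
by apply/eqP/esym/b_uniq.
Qed.

Lemma is_subrackT : is_subrack setT.
Proof.
apply/is_subrackP; split=> [a b _ _|a b c _ _ _|a c _ _].
- by rewrite inE.
- exact: rack_opDr.
have [b [def_c b_uniq]] := rack_op_solve a c.
by exists b; split=> [|b' [_ /b_uniq]//].
Qed.

Lemma is_subrackI S T : is_subrack S -> is_subrack T -> is_subrack (S :&: T).
Proof.
move=> /is_subrackP[S_cl _ S_A2] /is_subrackP[T_cl _ T_A2].
apply/is_subrackP; split=> [a b|a b c _ _ _|a c].
- by rewrite !inE => /andP[aS aT] /andP[bS bT]; rewrite S_cl ?T_cl.
- exact: rack_opDr.
rewrite !inE => /andP[aS aT] /andP[cS cT].
have [b [[bS def_c] _]] := S_A2 a c aS cS.
have [b' [[b'T def_c'] _]] := T_A2 a c aT cT.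
have [b0 [_ b0_uniq]] := rack_op_solve a c.
have eq_b := b0_uniq b def_c; have eq_b' := b0_uniq b' def_c'; subst b b'.
by exists b0; split=> [|b [_]]; [rewrite inE bS b'T | apply: b0_uniq].
Qed.

Definition gen_subrack S : {set X} :=
  \bigcap_(T : {set X} | is_subrack T && (S \subset T)) T.

Lemma gen_subrack_is_subrack S : is_subrack (gen_subrack S).
Proof.
rewrite /gen_subrack; elim/big_ind: _ => [|T U|T /andP[]//].
  exact: is_subrackT.
exact: is_subrackI.
Qed.

Lemma gen_subrack_subE S T :
  is_subrack T -> (gen_subrack S \subset T) = (S \subset T).
Proof.
move=> sr_T; apply/idP/idP=> [|sST]; last first.
  by apply: bigcap_inf; rewrite sr_T.
by apply: subset_trans; apply/bigcapsP=> U /andP[].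
Qed.

Record subrack := Subrack { subrack_set :> {set X}; _ : is_subrack subrack_set }.

HB.instance Definition _ := [isSub for subrack_set].
HB.instance Definition _ := [Finite of subrack by <:].

Implicit Types A B C : subrack.

Definition subrack_le A B : bool := subrack_set A \subset subrack_set B.

Fact subrack_le_refl : reflexive subrack_le.
Proof. by move=> A; apply: subxx. Qed.

Fact subrack_le_anti : antisymmetric subrack_le.
Proof. by move=> A B sAB; apply/val_inj/eqP; rewrite eqEsubset. Qed.

Fact subrack_le_trans : transitive subrack_le.
Proof. by move=> B A C; apply: subset_trans. Qed.

Fact subrack_display : Order.disp_t. Proof. exact: Order.Disp tt tt. Qed.

HB.instance Definition _ := Order.Le_isPOrder.Build subrack_display subrack
  subrack_le_refl subrack_le_anti subrack_le_trans.

Definition subrack_meet A B : subrack := Subrack (is_subrackI (valP A) (valP B)).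

Definition subrack_join A B : subrack :=
  Subrack (gen_subrack_is_subrack (subrack_set A :|: subrack_set B)).

Fact subrack_lexI A B C :
  (A <= subrack_meet B C)%O = (A <= B)%O && (A <= C)%O.
Proof. exact: subsetI. Qed.

Fact subrack_leUx A B C :
  (subrack_join A B <= C)%O = (A <= C)%O && (B <= C)%O.
Proof.
by rewrite -[LHS]/(gen_subrack _ \subset _) gen_subrack_subE ?(valP C) // subUset.
Qed.

HB.instance Definition _ := Order.POrder_MeetJoin_isLattice.Build
  subrack_display subrack subrack_lexI subrack_leUx.

End Subracks.

Definition lattice_isomorphic d (L : latticeType d) d' (L' : latticeType d') :
  Prop := exists f : {lmorphism L -> L'}, bijective f.

Local Open Scope group_scope.

(* [G \isog Grp p] says that [G] is the largest finite quotient of the group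
   presented by [p], hence that group itself when it is finite.  This is so
   for the presentations below: the relations let every element be written
   [a ^+ i * b ^+ j] with [i < 91] and [j < 3].  The lemma provides a finite
   group with such a presentation for e = 9 and e = 16 (a semidirect product;
   note that MathComp's [x ^ y] is [y^-1 * x * y]). *)
Lemma metacyclic_presentation e :
    coprime 91 e -> e ^ 3 = 1 %[mod 91] ->
  exists gT : finGroupType,
    [set: gT] \isog Grp (a : b : a ^+ 91, b ^+ 3, b * a * b^-1 = a ^+ e).
Proof.
move=> co_e e3; set z := Zp1 : 'Z_91.
have oz : #[z]%g = 91 by rewrite order_Zp1.
have z_gt1 : 1 < #[z]%g by rewrite oz.
have Ue : (e%:R : 'Z_#[z])%R \is a GRing.unit by rewrite unitZpE ?oz.
pose u : {unit 'Z_#[z]} := FinRing.unit _ Ue.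
have u3 : (u ^+ 3)%g = 1%g.
  apply/val_inj; rewrite FinRing.val_unitX -GRing.natrX.
  by apply/val_inj; rewrite /= !val_Zp_nat // oz e3.
have Gm : [set: Extremal.gtype 91 3 e] \isog
    Grp (a : b : a ^+ 91, b ^+ 3, a ^ b = a ^+ e).
  apply: Extremal.Grp => //; exists (Zp_unitm u); split.
  - exact: Aut_aut.
  - by rewrite order_dvdn -morphX ?inE // u3 morph1.
  rewrite autE ?cycle_id //= /cyclem /= val_Zp_nat //.
  by rewrite expg_mod_order.
exists (Extremal.gtype 91 3 e) => rT H; rewrite Gm /=.
have VE (x y : rT) : ((x ^ y)%g = (y^-1 * x * y)%g) by rewrite /conjg mulgA.
apply/existsP/existsP => -[[x y]] /= /eqP[<- x91 y3 xy].
  exists (x, y^-1)%g; rewrite /= !xpair_eqE x91 -xy invgK expgVn y3 invg1 VE.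
  by rewrite cycleV !eqxx.
exists (x, y^-1)%g; rewrite /= !xpair_eqE x91 -xy expgVn y3 invg1 VE invgK.
by rewrite cycleV !eqxx.
Qed.

(* Main.v *)
(* Let e be 9 or 16 and let b act on <a> by a |-> a^e.  Since 1 - e and 1 - e^2
   are units mod 91, every element of the group is either a translation a^t or
   a conjugate a^p b^k a^-p (k = 1, 2), a "rotation with centre p", and the rack
   operation reads:
     (t, 0) |> (s, 0) = (s, 0)         (t, 0) |> (q, l) = (q + t, l)
     (p, k) |> (s, 0) = (e^k s, 0)     (p, k) |> (q, l) = (p + e^k (q - p), l)
   Subracks are the same for both values of e, once translations are relabelled
   by an involution that preserves subgroups and exchanges multiplication by 9
   and by 16: such a relabelling exists as 9 and 16 agree mod 7 and are mutually
   inverse mod 13.  The point is that two rotations generate the translation by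
   a unit multiple of p - q (their commutator), hence by every multiple, so the
   rotation that the other operation would produce is there too.
   A rack isomorphism, however, would restrict to an affine isomorphism from the
   affine quandle of 9 mod 91 to that of 16^l mod 91, whence 9 = 16^l. *)

Require Import Defs.
From HB Require Import structures.
From mathcomp Require Import all_boot all_order all_algebra all_fingroup.
From mathcomp Require Import all_solvable ring.

Set Implicit Arguments.
Unset Strict Implicit.
Unset Printing Implicit Defensive.

Import Order.TTheory GRing.Theory.

(** * Subracks of finite racks and isomorphisms of their lattices *)

Section Subracks.
Variables X Y : finRackType.

(** Left multiplication is injective, so it permutes a finite set that it maps into itself; closure
    thus yields unique solvability. *)
Lemma is_subrackE (S : {set X}) :
  is_subrack S <-> {in S &, forall a b, rack_op a b \in S}.
Proof.
split=> [/is_subrackP[] //|S_cl]; apply/is_subrackP; split=> //.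
  by move=> a b c _ _ _; apply: rack_opDr.
move=> a c aS cS.
have op_inj : injective (rack_op a).
  move=> b b' eq_ab; have [b0 [_ b0_uniq]] := rack_op_solve a (rack_op a b').
  by rewrite -(b0_uniq b eq_ab) -(b0_uniq b' erefl).
have opS : [set rack_op a b | b in S] = S.
  apply/eqP; rewrite eqEcard card_imset // leqnn andbT.
  by apply/subsetP=> _ /imsetP[b bS ->]; apply: S_cl.
move: cS; rewrite -{1}opS => /imsetP[b bS ->].
by exists b; split=> // b' [_ /op_inj].
Qed.

(** Taking images under [f] and [g] gives mutually inverse monotone maps, and an order isomorphism
    preserves meets and joins. *)
Lemma subrack_lattice_isomorphic (f : X -> Y) (g : Y -> X) :
    cancel f g -> cancel g f ->
    (forall S, is_subrack S -> is_subrack (f @: S)) ->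
    (forall T, is_subrack T -> is_subrack (g @: T)) ->
  lattice_isomorphic (subrack X) (subrack Y).
Proof.
move=> fK gK fP gP.
pose F (A : subrack X) : subrack Y := Subrack (fP _ (valP A)).
pose G (B : subrack Y) : subrack X := Subrack (gP _ (valP B)).
have FK : cancel F G.
  by move=> A; apply/val_inj; rewrite /= -imset_comp (eq_imset _ fK) imset_id.
have GK : cancel G F.
  by move=> B; apply/val_inj; rewrite /= -imset_comp (eq_imset _ gK) imset_id.
have leF (A B : subrack X) : ((F A <= F B) = (A <= B))%O.
  apply/idP/idP=> [FAB|]; last exact: imsetS.
  by rewrite -(FK A) -(FK B); apply: (imsetS g FAB).
have leFG A B : ((F A <= B) = (A <= G B))%O by rewrite -leF GK.
have leGF A B : ((B <= F A) = (G B <= A))%O by rewrite -leF GK.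
have F_mono : {homo F : A B / (A <= B)%O >-> (A <= B)%O}.
  by move=> A B; rewrite leF.
have F_meet : {morph F : A B / Order.meet A B >-> Order.meet A B}.
  move=> A B; apply: le_anti; rewrite lexI !leF leIl leIr /=.
  by rewrite leGF lexI -!leGF leIl leIr.
have F_join : {morph F : A B / Order.join A B >-> Order.join A B}.
  move=> A B; apply: le_anti; rewrite leUx !leF leUl leUr /= andbT.
  by rewrite leFG leUx -!leFG leUl leUr.
pose Fo := Order.isOrderMorphism.Build _ _ _ _ F F_mono.
pose F1 : {omorphism subrack X -> subrack Y} := HB.pack F Fo.
pose Fl := Order.isLatticeMorphism.Build _ _ _ _ F1 F_meet F_join.
pose F2 : {lmorphism subrack X -> subrack Y} := HB.pack F Fo Fl.
by exists F2; exists G.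
Qed.

End Subracks.

(** * The two racks in coordinates *)

Section Model.
Local Open Scope ring_scope.

(* [(t, 0)] stands for [a ^+ t], and [(p, k)] with [k != 0] for
   [a ^+ p * b ^+ k * a ^- p]. *)
Definition coord_op (e : 'Z_91) (x y : 'Z_91 * 'Z_3) : 'Z_91 * 'Z_3 :=
  (if y.2 == 0 then e ^+ x.2 * y.1
   else if x.2 == 0 then x.1 + y.1
   else x.1 + e ^+ x.2 * (y.1 - x.1), y.2).

(* [78] and [14] are the CRT idempotents mod 7 and mod 13: this is [t] mod 7 and
   [t ^+ 5] mod 13.  It preserves subgroups, as it is a multiple of [t]. *)
Definition twist (t : 'Z_91) : 'Z_91 := t * (78%:R + 14%:R * t ^+ 4).

Lemma forall_Z91 (P : pred 'Z_91) :
  all (fun m => P m%:R) (iota 0 91) -> forall t, P t.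
Proof.
move=> /allP P_nat t; rewrite -(natr_Zp t); apply: P_nat.
by rewrite mem_iota add0n; apply: (ltn_ord t).
Qed.

(** Mod 13 the square of the map is [t ^+ 25 = t], since 25 = 1 mod 12. *)
Lemma twistK : involutive twist.
Proof. by move=> t; apply/eqP; move: t; apply: forall_Z91; vm_compute. Qed.

(** Mod 7 both factors are 2; mod 13 the fifth power of 9 is 3, that is 16. *)
Lemma twist_9 t : twist (9%:R * t) = 16%:R * twist t.
Proof. by apply/eqP; move: t; apply: forall_Z91; vm_compute. Qed.

Lemma twist_16 t : twist (16%:R * t) = 9%:R * twist t.
Proof. by rewrite -{1}(twistK t) -twist_9 twistK. Qed.

Definition coord_twist (x : 'Z_91 * 'Z_3) : 'Z_91 * 'Z_3 :=
  (if x.2 == 0 then twist x.1 else x.1, x.2).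

Lemma coord_twistK : involutive coord_twist.
Proof.
by case=> t k; rewrite /coord_twist /=; case: eqP => //= _; rewrite twistK.
Qed.

Lemma expr9_3 : 9%:R ^+ 3 = 1 :> 'Z_91.
Proof. by apply/eqP; vm_compute. Qed.

Lemma expr16_3 : 16%:R ^+ 3 = 1 :> 'Z_91.
Proof. by apply/eqP; vm_compute. Qed.

Lemma unit_1sub9X (k : 'Z_3) :
  k != 0 -> (1 - 9%:R ^+ k : 'Z_91) \is a GRing.unit.
Proof. by case: k => [[|[|[]]]] //= lt_k _; vm_compute. Qed.

Lemma unit_1sub16X (k : 'Z_3) :
  k != 0 -> (1 - 16%:R ^+ k : 'Z_91) \is a GRing.unit.
Proof. by case: k => [[|[|[]]]] //= lt_k _; vm_compute. Qed.

(** * Closed sets for [e] are, after twisting, closed for [e'] *)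

Section Closed.
Variables e e' : 'Z_91.
Hypothesis e3 : e ^+ 3 = 1.
Hypothesis unit_1sub_e : forall k : 'Z_3, k != 0 -> 1 - e ^+ k \is a GRing.unit.
Hypothesis twist_e' : forall t, twist (e' * t) = e * twist t.

Variable S : {set 'Z_91 * 'Z_3}.
Hypothesis S_cl : {in S &, forall x y, coord_op e x y \in S}.

Lemma closed_translation (d q : 'Z_91) (l : 'Z_3) n :
    (forall z, (z, l) \in S -> (z + d, l) \in S) -> (q, l) \in S ->
  (q + n * d, l) \in S.
Proof.
move=> S_d qS; rewrite -(natr_Zp n); elim: (n : nat) => [|m IHm].
  by rewrite mul0r addr0.
by rewrite -natr1 mulrDl mul1r addrA S_d.
Qed.

Lemma rotation_commutator (p q z : 'Z_91) (k l : 'Z_3) :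
    k != 0 -> l != 0 -> (p, k) \in S -> (q, l) \in S -> (z, l) \in S ->
  (z + (1 - e ^+ k) * (1 - e ^+ l) * (p - q), l) \in S.
Proof.
move=> k0 l0 pS qS zS.
have stepP w : (w, l) \in S -> (p + e ^+ k * (w - p), l) \in S.
  by move=> wS; have := S_cl pS wS; rewrite /coord_op /= (negPf k0) (negPf l0).
have stepQ w : (w, l) \in S -> (q + e ^+ l * (w - q), l) \in S.
  by move=> wS; have := S_cl qS wS; rewrite /coord_op /= (negPf l0).
have e3X (m : nat) : (e ^+ m) ^+ 3 = 1 by rewrite exprAC e3 expr1n.
(* [e ^+ 3 = 1], so squares are inverses and this word is the commutator. *)
have := zS => /stepQ/stepQ/stepP/stepP/stepQ/stepP.
set c := e ^+ k; set d := e ^+ l; congr (in_mem (_, _) _).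
have c3 : c ^+ 3 = 1 := e3X k; have d3 : d ^+ 3 = 1 := e3X l.
by ring: c3 d3.
Qed.

Lemma twist_eX t k : twist (e' ^+ k * t) = e ^+ k * twist t.
Proof.
by elim: k => [|k IHk]; rewrite ?mul1r // !exprS -!mulrA twist_e' IHk.
Qed.

Lemma coord_twist_closed x y :
  x \in S -> y \in S ->
  coord_twist (coord_op e' (coord_twist x) (coord_twist y)) \in S.
Proof.
case: x y => [p k] [q l] pS qS; rewrite /coord_twist /coord_op /=.
have [l0 | l0] := eqVneq l 0; rewrite /= ?l0 ?eqxx ?(negPf l0) /=.
  have := S_cl pS qS; rewrite /coord_op /= l0 eqxx twist_eX twistK.
  exact.
have [k0 | k0] := eqVneq k 0.
  (* [twist p] is a multiple of [p], so iterating the translation by [p] reaches it. *)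
  rewrite addrC /twist mulrC; apply: closed_translation => // z zS.
  by have := S_cl pS zS; rewrite /coord_op /= k0 (negPf l0) addrC.
pose u := (1 - e ^+ k) * (1 - e ^+ l).
have Uu : u \is a GRing.unit by rewrite unitrM !unit_1sub_e.
(* The centre sought is [q + (1 - e' ^+ k) * (p - q)]; as [u] is a unit, this is [q] shifted by a
   multiple of the commutator translation. *)
rewrite [X in (X, _)](_ : _ = q + ((1 - e' ^+ k) / u) * (u * (p - q))).
  apply: closed_translation => // z zS; exact: rotation_commutator.
by rewrite mulrA divrK //; ring.
Qed.

End Closed.

(** * Non-isomorphism of the coordinate racks *)

Lemma coord_op_9_16_not_iso (f : 'Z_91 * 'Z_3 -> 'Z_91 * 'Z_3) :
  injective f -> ~ {morph f : x y / coord_op 9%:R x y >-> coord_op 16%:R x y}.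
Proof.
move=> f_inj fM; set l := (f (0, 1)).2.
(* A product keeps the second coordinate of its right factor, and translations carry [(0, 1)] to
   every [(q, 1)]. *)
have f_level q : (f (q, 1)).2 = l.
  have -> : (q, 1) = coord_op 9%:R (q, 0) (0, 1).
    by rewrite /coord_op /= addr0.
  by rewrite fM.
(* Translations act trivially on each other, whereas [(1, 1)] moves [(0, 1)]. *)
have l0 : l != 0.
  apply/eqP => l0.
  suff /f_inj/eqP : f (coord_op 9%:R (1, 1) (0, 1)) = f (0, 1) by [].
  rewrite fM /coord_op !f_level l0 eqxx mul1r.
  by rewrite [RHS]surjective_pairing f_level l0.
pose h q := (f (q, 1)).1; pose c : 'Z_91 := 16%:R ^+ l.
have fE q : f (q, 1) = (h q, l) by rewrite -(f_level q) [LHS]surjective_pairing.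
have h_op p q : h (p + 9%:R * (q - p)) = h p + c * (h q - h p).
  have := fM (p, 1) (q, 1).
  by rewrite {1}/coord_op /= !fE /coord_op /= (negPf l0) => -[].
have c3 : c ^+ 3 = 1 by rewrite /c exprAC expr16_3 expr1n.
have h_op0 q : h (9%:R * q) = h 0 + c * (h q - h 0).
  by have := h_op 0 q; rewrite add0r subr0.
have n91 : 91%:R = 0 :> 'Z_91 by apply/eqP; vm_compute.
(* [34] is the inverse of [1 - 9] mod 91, and [9 ^+ 3 = 1]: the word below acts
   as the translation by [t]. *)
have h_trans z t : h (z + t) = h z + (1 - c) * (h (34%:R * t) - h 0).
  have := h_op (34%:R * t) (9%:R * (9%:R * z)).
  rewrite (h_op0 (9%:R * z)) (h_op0 z).
  have -> : 34%:R * t + 9%:R * (9%:R * (9%:R * z) - 34%:R * t) = z + t.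
    (* The two sides differ by [728 z - 273 t = 91 (8 z - 3 t)]. *)
    by rewrite -[RHS]addr0 -(mul0r (8%:R * z - 3%:R * t)) -n91; ring.
  by move->; ring: c3.
set d := (1 - c) * (h (34%:R * 1) - h 0).
have h_affine t : h t = h 0 + t * d.
  rewrite -(natr_Zp t); elim: (t : nat) => [|n IHn].
    by rewrite mul0r addr0.
  by rewrite -natr1 (h_trans n%:R) -/d IHn mulrDl mul1r addrA.
have cd : (c - 9%:R) * d = 0.
  have := h_op0 1; rewrite mulr1 (h_affine 9%:R) (h_affine 1).
  by move/addrI => e9; rewrite mulrBl e9; ring.
have /f_inj[/eqP] : f (c - 9%:R, 1) = f (0, 1) by rewrite !fE h_affine cd addr0.
(* For [l] equal to 1 or 2, [c] is 16 or 74, never 9. *)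
by apply/negP; rewrite /c; case: (l) l0 => [[|[|[|]]]] // lt_l _; vm_compute.
Qed.

End Model.

(** * Coordinates on the presented groups *)

Section Metacyclic.
Local Open Scope group_scope.

(** The semidirect product of order 273 satisfies the relations, so it is a quotient of [gT]. *)
Lemma card_metacyclic_presentation (e : nat) (gT : finGroupType) :
    coprime 91 e -> (e ^ 3 = 1 %[mod 91])%N ->
    [set: gT] \isog Grp (a : b : a ^+ 91, b ^+ 3, b * a * b^-1 = a ^+ e) ->
  #|gT| >= 273.
Proof.
move=> co_e e3 presG; set z := Zp1 : 'Z_91.
have oz : #[z] = 91 by rewrite order_Zp1.
have z_gt1 : 1 < #[z] by rewrite oz.
have Ue : (e%:R : 'Z_#[z])%R \is a GRing.unit by rewrite unitZpE ?oz.
pose u : {unit 'Z_#[z]} := FinRing.unit _ Ue.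
have u3 : u ^+ 3 = 1.
  apply/val_inj; rewrite FinRing.val_unitX -natrX.
  by apply/val_inj; rewrite /= !val_Zp_nat // oz e3.
have presK : [set: Extremal.gtype 91 3 e] \isog
    Grp (a : b : a ^+ 91, b ^+ 3, a ^ b = a ^+ e).
  apply: Extremal.Grp => //; exists (Zp_unitm u); split.
  - exact: Aut_aut.
  - by rewrite order_dvdn -morphX ?inE // u3 morph1.
  rewrite autE ?cycle_id //= /cyclem /= val_Zp_nat //.
  by rewrite expg_mod_order.
have homKG : [set: Extremal.gtype 91 3 e] \homg [set: gT].
  rewrite presG.
  have /existsP[[x y] /= /eqP[defK x91 y3 xy]] := isoGrp_hom presK.
  apply/existsP; exists (x, y^-1); rewrite /= !xpair_eqE x91 -xy invgK.
  by rewrite expgVn y3 invg1 conjgE mulgA cycleV defK !eqxx.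
rewrite -!cardsT; apply: leq_trans (dvdn_leq (cardG_gt0 _) (card_homg homKG)).
by rewrite Extremal.card.
Qed.

(** The normal form [a ^+ i * b ^+ j] makes the coordinate map onto; injectivity follows by
    counting, as the group has at least 273 elements. *)
Lemma metacyclic_coordinates (e : nat) (gT : finGroupType) :
    coprime 91 e -> (e ^ 3 = 1 %[mod 91])%N ->
    (forall k : 'Z_3, k != 0%R ->
      (1 - e%:R ^+ k : 'Z_91)%R \is a GRing.unit) ->
    [set: gT] \isog Grp (a : b : a ^+ 91, b ^+ 3, b * a * b^-1 = a ^+ e) ->
  exists2 c : 'Z_91 * 'Z_3 -> group_rack gT, bijective c
    & forall x y, c (coord_op (e%:R)%R x y) = rack_op (c x) (c y).
Proof.
move=> co_e e3 unit_1sub_e presG.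
have cardG := card_metacyclic_presentation co_e e3 presG.
have /existsP[[a b] /= /eqP[genG a91 b3 ab]] := isoGrp_hom presG.
pose A (t : 'Z_91) := a ^+ t.
have A_nat m : A (m%:R)%R = a ^+ m by rewrite /A val_Zp_nat // expg_mod.
have AD s t : A (s + t)%R = A s * A t.
  by rewrite -(natr_Zp s) -(natr_Zp t) -natrD !A_nat expgD.
have AN t : A (- t)%R = (A t)^-1.
  by apply/eqP; rewrite eq_sym eq_invg_mul -AD addrN.
have bA k s : A s ^ b ^- k = A (e%:R ^+ k * s)%R.
  have ba t : A t ^ b^-1 = A (e%:R * t)%R.
    rewrite -(natr_Zp t) -natrM !A_nat conjXg expgM -ab.
    by rewrite conjgE invgK mulgA.
  elim: k => [|k IHk]; first by rewrite invg1 conjg1 mul1r.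
  by rewrite expgS invMg conjgM IHk ba mulrA -exprS.
have AA s t : A s ^ A t = A s by rewrite conjgE -AN -!AD; congr A; ring.
have bb l m : b ^+ l ^ b ^- m = b ^+ l.
  by apply/conjg_fixP/commgP/commuteV/commuteX2.
pose c (x : 'Z_91 * 'Z_3) : gT :=
  if x.2 == 0%R then A x.1 else (b ^+ x.2) ^ A (- x.1)%R.
have c_op x y : c (coord_op (e%:R)%R x y) = c y ^ (c x)^-1.
  case: x y => [p k] [q l]; rewrite /coord_op /c /=.
  have [l0 | l0] := eqVneq l 0%R; have [k0 | k0] := eqVneq k 0%R.
  - by rewrite k0 mul1r -AN AA.
  - by rewrite -conjVg [(_ ^- _) ^ _]conjgE -AN opprK !conjgM AA bA AA.
  - by rewrite -AN -conjgM -AD; congr (_ ^ A _); ring.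
  rewrite -conjVg -conjgM [(_ ^- _) ^ _]conjgE -AN opprK !mulgA -AD.
  rewrite [A _ * b ^- _]conjgC bA -mulgA -AD conjgM bb.
  by congr (_ ^ A _); ring.
have c_surj g : g \in codom c.
  have : g \in [set: gT] by rewrite inE.
  rewrite -genG norm_joinEr; last first.
    rewrite cycle_subG -groupV inE -cycleJ cycle_subG.
    by rewrite -{1}[a]expg1 -(A_nat 1%N) -(expg1 b) bA mem_cycle.
  case/mulsgP=> _ _ /cycleP[i ->] /cycleP[j ->] ->.
  pose k : 'Z_3 := inZp j; have -> : b ^+ j = b ^+ k by rewrite expg_mod.
  have [k0 | k0] := eqVneq k 0%R.
    by apply/codomP; exists ((i%:R)%R, k); rewrite /c k0 eqxx A_nat mulg1.
  (* The centre [p] solves [p * (1 - e ^+ k) = i], because [a ^+ p * b ^+ k * a ^- p] has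
     translation part [p * (1 - e ^+ k)]. *)
  apply/codomP; exists ((i%:R / (1 - e%:R ^+ k))%R, k).
  rewrite /c (negPf k0) -A_nat /= conjgE -AN opprK.
  rewrite [b ^+ k * A _]conjgCV bA mulgA -AD; congr (A _ * _).
  by rewrite mulrN -[X in (X - _)%R]mul1r -mulrBl
    mulrCA mulrV ?mulr1 ?unit_1sub_e.
have c_bij : bijective c.
  have cardM : #|{: 'Z_91 * 'Z_3}| = 273 by rewrite card_prod !card_ord.
  have codomT : codom c =i predT by move=> g; rewrite c_surj.
  have c_inj : injective c.
    have /image_injP c_inj :
        #|image c predT| == #|[pred x : 'Z_91 * 'Z_3 | true]|.
      by rewrite eqn_leq leq_image_card [X in (X <= _)%N]cardM (eq_card codomT).
    by move=> x y; apply: c_inj.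
  by apply: (inj_card_bij c_inj); rewrite -(eq_card codomT) leq_image_card.
exists c => // x y.
by rewrite c_op conjgE invgK mulgA.
Qed.

End Metacyclic.

(** * Transfer of subracks between the groups *)

Section Transfer.
Variables (G H : finGroupType) (e e' : 'Z_91).
Variables (cG : 'Z_91 * 'Z_3 -> group_rack G)
  (dG : group_rack G -> 'Z_91 * 'Z_3).
Variable cH : 'Z_91 * 'Z_3 -> group_rack H.
Hypotheses (cGK : cancel cG dG) (dGK : cancel dG cG).
Hypothesis cG_op : forall x y, cG (coord_op e x y) = rack_op (cG x) (cG y).
Hypothesis cH_op : forall x y, cH (coord_op e' x y) = rack_op (cH x) (cH y).
Hypothesis e3 : (e ^+ 3 = 1)%R.
Hypothesis unit_1sub_eX :
  forall k : 'Z_3, k != 0%R -> (1 - e ^+ k)%R \is a GRing.unit.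
Hypothesis twist_e' : forall t, (twist (e' * t) = e * twist t)%R.

(** A product of two twisted points is the twist of a point of the closed set [T], because
    [coord_twist] is its own inverse. *)
Lemma twist_subrack (S : {set group_rack G}) :
  is_subrack S -> is_subrack ((fun g => cH (coord_twist (dG g))) @: S).
Proof.
move=> /is_subrackE S_cl.
apply/is_subrackE => _ _ /imsetP[x xS ->] /imsetP[y yS ->].
pose T := cG @^-1: S.
have T_cl : {in T &, forall u v, coord_op e u v \in T}.
  by move=> u v; rewrite !inE cG_op; apply: S_cl.
have xT : dG x \in T by rewrite inE dGK.
have yT : dG y \in T by rewrite inE dGK.
have := coord_twist_closed e3 unit_1sub_eX twist_e' T_cl xT yT.
rewrite inE => wS; apply/imsetP; eexists; first exact: wS.
by rewrite cGK coord_twistK cH_op.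
Qed.

End Transfer.

Unset Implicit Arguments.

Local Open Scope group_scope.

Theorem proposition4 (G0 H0 : finGroupType)
    (presG0 : [set: G0] \isog
       Grp (a : b : a ^+ 91, b ^+ 3, b * a * b^-1 = a ^+ 9))
    (presH0 : [set: H0] \isog
       Grp (alpha : beta : alpha ^+ 91, beta ^+ 3,
              beta * alpha * beta^-1 = alpha ^+ 16)) :
  lattice_isomorphic (subrack (group_rack G0)) (subrack (group_rack H0)) /\
  ~ rack_isomorphic (group_rack G0) (group_rack H0).
Proof.
have [cG [dG cGK dGK] cG_op] :=
  @metacyclic_coordinates 9 G0 isT (erefl _) unit_1sub9X presG0.
have [cH [dH cHK dHK] cH_op] :=
  @metacyclic_coordinates 16 H0 isT (erefl _) unit_1sub16X presH0.
split.
  apply: (@subrack_lattice_isomorphic _ _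
    (fun g => cH (coord_twist (dG g))) (fun h => cG (coord_twist (dH h)))).
  - by move=> g; rewrite cHK coord_twistK dGK.
  - by move=> h; rewrite cGK coord_twistK dHK.
  - by apply: (twist_subrack cGK dGK cG_op cH_op expr9_3 unit_1sub9X twist_16).
  by apply: (twist_subrack cHK dHK cH_op cG_op expr16_3 unit_1sub16X twist_9).
case=> F /bij_inj F_inj FM.
apply: (@coord_op_9_16_not_iso (dH \o F \o cG)) => [|x y].
  exact: inj_comp (inj_comp (can_inj dHK) F_inj) (can_inj cGK).
by rewrite /= cG_op FM -{1}(dHK (F (cG x))) -{1}(dHK (F (cG y))) -cH_op cHK.
Qed.
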